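(* Let $n$ be a positive integer whose Collatz sequence has a maximum, and let $p$ be the peak value of the Collatz sequence starting at $n$. Then $p\equiv 0 \pmod 4$.
   Context: The Collatz map $T$ on the positive integers is $T(m)=m/2$ if $m$ is even and $T(m)=3m+1$ if $m$ is odd; $T^i$ denotes its $i$-fold iterate. The Collatz sequence starting at $n$ is the infinite sequence $n, T(n), T^2(n),\dots$ (it is not stopped at $1$). Its peak value is the maximum of all its terms. *)

(* Defs.v *)
From mathcomp Require Import all_boot.

Set Implicit Arguments.
Unset Strict Implicit.
Unset Printing Implicit Defensive.

(* Only the values at m > 0 are meaningful; positive integers are mapped to
   positive integers, so the junk value collatz 0 = 0 is never reached from
   a positive start. *)
Definition collatz (m : nat) : nat := if odd m then 3 * m + 1 else m %/ 2.

Definition collatz_seq (n i : nat) : nat := iter i collatz n.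

(* p is the maximum of the infinite sequence u: it is attained and bounds
   every term. *)
Definition is_max_of_seq (u : nat -> nat) (p : nat) : Prop :=
  (exists i, u i = p) /\ (forall i, u i <= p).

Definition is_collatz_peak (n p : nat) : Prop :=
  is_max_of_seq (collatz_seq n) p.

(* Main.v *)
Require Import Defs.
From mathcomp Require Import all_boot zify.

(** The peak belongs to the orbit, so the terms that follow it are bounded by
    it as well. If the peak [p] were odd, the next term [3 * p + 1] would exceed
    it; if it were twice an odd number, halving would lead to the odd number
    [p / 2], and the term after that, [3 * (p / 2) + 1], would exceed it.
    Hence [p] is a multiple of 4. *)

(** The sequence is not stopped at the peak, so restarting it there yields a
    tail of the same sequence. *)
Lemma collatz_iter_le_peak n p k :
  is_collatz_peak n p -> iter k collatz p <= p.
Proof.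
move=> [[i <-] le_peak].
by rewrite {1}/collatz_seq -iterD; apply: le_peak.
Qed.

Lemma collatz_odd_gt m : odd m -> m < collatz m.
Proof. by rewrite /collatz => ->; lia. Qed.

Lemma collatz2_double_odd_gt m : odd m -> m.*2 < collatz (collatz m.*2).
Proof.
move=> m_odd; have -> : collatz m.*2 = m.
  by rewrite /collatz odd_double divn2 doubleK.
by rewrite /collatz m_odd; lia.
Qed.

Theorem theorem2p10 (n p : nat) (n_gt0 : 0 < n) (peak_p : is_collatz_peak n p) :
  p = 0 %[mod 4].
Proof.
have le1 := collatz_iter_le_peak n p 1 peak_p.
have le2 := collatz_iter_le_peak n p 2 peak_p.
have p_even : ~~ odd p.
  by apply/negP => /collatz_odd_gt; rewrite ltnNge le1.
have pE : p = p./2.*2 by rewrite even_halfK.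
have half_even : ~~ odd p./2.
  by apply/negP => /collatz2_double_odd_gt; rewrite -pE ltnNge le2.
by lia.
Qed.
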